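(* Let $X$ be a space and let $\mathscr{I}$ be an ideal in an upper semi-lattice $(\mathscr{L},\subseteq)$, where $\mathscr{L}\subseteq\mathscr{P}(X)$. Let $\mathscr{Z}(X)\subseteq\mathscr{L}$. Then \[C^{\mathscr I}_0(X)=\big\{f\in C_b(X):|f|^{-1}\big([1/n,\infty)\big)\text{ is null for each positive integer }n\big\}.\]
   Context: A space is a topological space and $\mathscr{P}(X)$ is the power set of $X$. $C_b(X)$ is the algebra of continuous bounded $f:X\to\mathbb{R}$. $\mathscr{Z}(X)$ is the set of all zero-sets $f^{-1}(0)$ of continuous real-valued functions $f$ on $X$. An upper semi-lattice is a partially ordered set in which any two elements $A,B$ have a least upper bound $A\vee B$. For $\mathscr{L}\subseteq\mathscr{P}(X)$ ordered by inclusion, $A\vee B$ is computed in $\mathscr{L}$ and need not equal $A\cup B$. An ideal $\mathscr{I}$ in $(\mathscr{L},\subseteq)$ is a non-empty subset of $\mathscr{L}$ such that $A\vee B\in\mathscr{I}$ whenever $A,B\in\mathscr{I}$, and $T\in\mathscr{I}$ whenever $T\in\mathscr{L}$ and $T\subseteq A$ for some $A\in\mathscr{I}$. Elements of $\mathscr{I}$ are called null. A neighborhood of a set $A$ in $X$ is a set $U\subseteq X$ with $A\subseteq\mathrm{int}_XU$. $C^{\mathscr I}_0(X)=\{f\in C_b(X):|f|^{-1}([1/n,\infty))\text{ has a null neighborhood in }X\text{ for each positive integer }n\}$. *)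

(* Defs.v *)
From HB Require Import structures.
From mathcomp Require Import all_boot all_order all_algebra.
From mathcomp Require Import all_classical all_reals all_analysis.
Import Order.TTheory GRing.Theory Num.Theory.
Import numFieldNormedType.Exports.

Set Implicit Arguments.
Unset Strict Implicit.
Unset Printing Implicit Defensive.

Local Open Scope classical_set_scope.
Local Open Scope ring_scope.

(* The least upper bound is taken among the members of L: it contains
   A `|` B but may be larger. *)
Definition is_join (T : Type) (L : set (set T)) (A B C : set T) : Prop :=
  [/\ L C, A `<=` C, B `<=` C &
      forall D, L D -> A `<=` D -> B `<=` D -> C `<=` D].

Definition upper_semilattice (T : Type) (L : set (set T)) : Prop :=
  forall A B, L A -> L B -> exists C, is_join L A B C.

(* Joins are unique, so quantifying over all joins C of A and B speaks about
   the single element A \/ B of L. *)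
Record is_ideal (T : Type) (L I : set (set T)) : Prop := IsIdeal {
  ideal_sub : I `<=` L;
  ideal_nonempty : I !=set0;
  ideal_join : forall A B C, I A -> I B -> is_join L A B C -> I C;
  ideal_down : forall A S, I A -> L S -> S `<=` A -> I S
}.

Definition neighborhood (X : topologicalType) (A U : set X) : Prop :=
  A `<=` U°.

Definition zero_sets (R : realType) (X : topologicalType) : set (set X) :=
  [set Z | exists2 f : X -> R, continuous f & Z = f @^-1` [set 0]].

Arguments zero_sets : clear implicits.

Definition Cb (R : realType) (X : topologicalType) : set (X -> R) :=
  [set f | continuous f /\ bounded_fun f].

Arguments Cb : clear implicits.

(* |f|^{-1}([1/n, oo)) *)
Definition abs_ge (R : realType) (X : Type) (f : X -> R) (n : nat) : set X :=
  (fun x => `|f x|) @^-1` [set` `[n%:R^-1, +oo[].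

Definition C0 (R : realType) (X : topologicalType) (I : set (set X)) :
    set (X -> R) :=
  [set f | Cb R X f /\
     forall n : nat, (0 < n)%N ->
       exists2 U, I U & neighborhood (abs_ge f n) U].

Arguments C0 R {X} I.

(* Main.v *)
Require Import Defs.
From HB Require Import structures.
From mathcomp Require Import all_boot all_order all_algebra.
From mathcomp Require Import all_classical all_reals all_analysis.
Import Order.TTheory GRing.Theory Num.Theory.
Import numFieldNormedType.Exports.

Local Open Scope classical_set_scope.
Local Open Scope ring_scope.

(** The sets [|f| >= 1/n] are zero-sets, hence members of [L], so such a set
    is null as soon as it lies inside some null set, in particular inside a
    null neighborhood of itself ([zero_sets_abs_ge]). Conversely the strict
    inequality [1/(n+1) < 1/n] leaves room for the open set [|f| > 1/(n+1)]
    between the levels [n] and [n+1], so the level set [n+1], when null, is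
    itself a null neighborhood of the level set [n]
    ([neighborhood_abs_geS]). *)

Lemma continuous_norm_comp (R : realType) (X : topologicalType) (f : X -> R) :
  continuous f -> continuous (fun x => `|f x|).
Proof. by move=> cf x; apply: cvg_norm; exact: cf. Qed.

(** With [g = |f| - 1/n], the set [g >= 0] is the zero-set of the continuous
    function [g - |g|]. *)
Lemma zero_sets_abs_ge (R : realType) (X : topologicalType) (f : X -> R)
    (n : nat) :
  continuous f -> zero_sets R X (abs_ge f n).
Proof.
move=> cf; pose g x := `|f x| - n%:R^-1.
have cg : continuous g.
  by move=> x; apply: cvgB; [exact: continuous_norm_comp | exact: cvg_cst].
exists (fun x => g x - `|g x|).
  by move=> x; apply: cvgB; [exact: cg | exact: continuous_norm_comp].
rewrite /abs_ge; apply/seteqP; split => x /=; rewrite in_itv /= andbT -subr_ge0.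
  by move=> g_ge0; rewrite ger0_norm// subrr.
by move=> /eqP; rewrite subr_eq0 => /eqP gE; rewrite -/(g x) gE.
Qed.

Lemma neighborhood_abs_geS (R : realType) (X : topologicalType) (f : X -> R)
    (n : nat) :
  continuous f -> (0 < n)%N -> neighborhood (abs_ge f n) (abs_ge f n.+1).
Proof.
move=> cf n_gt0; pose V := [set x | n.+1%:R^-1 < `|f x|].
have oV : open V.
  apply: (@open_comp _ _ (fun x => `|f x|) [set y | n.+1%:R^-1 < y]).
    by move=> x _; exact: continuous_norm_comp.
  exact: open_gt.
have VS : V `<=` abs_ge f n.+1.
  by move=> x; rewrite /V /abs_ge /= in_itv /= andbT => /ltW.
apply: (@subset_trans _ V); last by rewrite -open_subsetE.
move=> x; rewrite /abs_ge /V /= in_itv /= andbT; apply: lt_le_trans.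
by rewrite ltf_pV2 ?posrE ?ltr0n// ltr_nat.
Qed.

Theorem proposition3p3 (R : realType) (X : topologicalType)
    (L I : set (set X)) (hL : upper_semilattice L) (hI : is_ideal L I)
    (hZ : zero_sets R X `<=` L) :
  C0 R I =
  [set f : X -> R | Cb R X f /\ forall n : nat, (0 < n)%N -> I (abs_ge f n)].
Proof.
apply/seteqP; split => f /= [fCb null]; split=> // n n_gt0;
  have [cf _] := fCb.
  have [U IU nU] := null n n_gt0.
  apply: (ideal_down hI IU); first by apply: hZ; exact: zero_sets_abs_ge.
  exact: subset_trans nU (@interior_subset _ U).
by exists (abs_ge f n.+1); [exact: null | exact: neighborhood_abs_geS].
Qed.
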